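(* Let $G=(V,E,\mathbf{w}_0)$ be a connected finite weighted graph with $E=\{e_1,\dots,e_m\}$ and initial weight $\mathbf{w}_0=(w_{0,e})_{e\in E}\in\mathbb{R}_+^m$. Then the cohesion flow $$\begin{cases} w_e'(t)=C_e(t), & t>0,\\ w_e(t)>0, & t>0,\\ w_e(0)=w_{0,e}, & \end{cases}\qquad \forall e\in E,$$ where $C_e(t)$ is the cohesion of $e$ computed with respect to the weight vector $\mathbf{w}(t)=(w_e(t))_{e\in E}$, admits a unique global solution $\mathbf{w}(t)=(w_e(t))_{e\in E}\in\mathbb{R}_+^m$ for all $t\in[0,+\infty)$. Moreover, for every edge $e\in E$, $w_e(t)$ is strictly increasing in $t$ and $\lim_{t\to+\infty}w_e(t)=+\infty$.
   Context: $\mathbb{R}_+^m=\{\mathbf{a}=(a_1,\dots,a_m)\in\mathbb{R}^m: a_j>0 \text{ for all } 1\le j\le m\}$. A connected finite weighted graph $G=(V,E,\mathbf{w})$ is a finite connected simple undirected graph with vertex set $V=\{x_1,\dots,x_n\}$, edge set $E=\{e_1,\dots,e_m\}$, and edge weights $\mathbf{w}=(w_e)_{e\in E}$, $w_e>0$ for all $e$. Write $x\sim y$ if $x,y$ are adjacent, $xy$ for the edge joining them, and $w_{xy}=w_{yx}$ for its weight. For $x\in V$ let $\mathscr{N}_x=\{u\in V: u\sim x\text{ or }u=x\}$, and for an edge $xy$ let $\mathscr{N}_{xy}=\{z\in V: z\sim x\text{ and }z\sim y\}$. Cohesion. For an edge $e=xy\in E$ and weight vector $\mathbf{w}$, set $$A_{xy}=\sum_{u\in\mathscr{N}_x\setminus\mathscr{N}_y}\frac1{w_{xu}}+\sum_{u\in\mathscr{N}_y\setminus\mathscr{N}_x}\frac1{w_{yu}},\qquad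 B_{xy}=\sum_{z\in\mathscr{N}_{xy}}\left(\frac1{w_{xz}}+\frac1{w_{yz}}\right),$$ $$\widetilde{C}_{xy}=\begin{cases}\dfrac{A_{xy}-B_{xy}}{A_{xy}+B_{xy}}, & A_{xy}+B_{xy}>0,\\ 0, & A_{xy}+B_{xy}=0.\end{cases}$$ The cohesion of $e=xy$ is $C_e=C_{xy}=\exp(\widetilde{C}_{xy})$. A solution of the flow on $[0,+\infty)$ is a function $\mathbf{w}$ that is continuous on $[0,+\infty)$, differentiable for $t>0$, and satisfies the displayed system. *)

(* Defs.v *)
From mathcomp Require Import all_boot all_order all_algebra.
From mathcomp Require Import all_classical all_reals all_analysis.

Set Implicit Arguments.
Unset Strict Implicit.
Unset Printing Implicit Defensive.

Import Order.TTheory GRing.Theory Num.Theory.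
Import numFieldNormedType.Exports.

Local Open Scope classical_set_scope.
Local Open Scope ring_scope.

Record sgraph (V : finType) := SGraph {
  adj : rel V;
  adj_sym : symmetric adj;
  adj_irr : irreflexive adj }.

Definition connected_graph (V : finType) (G : sgraph V) : Prop :=
  (0 < #|V|)%N /\ forall x y : V, connect (adj G) x y.

Definition edge_set (V : finType) (G : sgraph V) : {set {set V}} :=
  [set A : {set V} | [exists x, exists y, adj G x y && (A == [set x; y]%SET)]].

Definition edge (V : finType) (G : sgraph V) := {A : {set V} | A \in edge_set G}.

(* N_x contains x itself, whereas N_xy, for an edge xy, contains neither x
   nor y. *)
Definition closed_nbhd (V : finType) (G : sgraph V) (x : V) : {set V} :=
  [set u | adj G u x || (u == x)].

Definition common_nbhd (V : finType) (G : sgraph V) (x y : V) : {set V} :=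
  [set z | adj G z x && adj G z y].

Section Cohesion.
Variables (R : realType) (V : finType) (G : sgraph V).
Implicit Types (w : edge G -> R) (x y : V).

Definition positive_weights w : Prop := forall e, 0 < w e.

(* The weight w_xy of the edge {x, y}; the default value 0 is only returned
   when x and y are not adjacent, which never happens in the sums below when
   xy is an edge: then x and y belong to both N_x and N_y. *)
Definition weight w x y : R := oapp w 0 (insub [set x; y]%SET).

Definition cohA w x y : R :=
  \sum_(u in closed_nbhd G x :\: closed_nbhd G y) 1 / weight w x u +
  \sum_(u in closed_nbhd G y :\: closed_nbhd G x) 1 / weight w y u.

Definition cohB w x y : R :=
  \sum_(z in common_nbhd G x y) (1 / weight w x z + 1 / weight w y z).

Definition cohC_tilde w x y : R :=
  if 0 < cohA w x y + cohB w x y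
  then (cohA w x y - cohB w x y) / (cohA w x y + cohB w x y)
  else 0.

Definition cohesion w x y : R := expR (cohC_tilde w x y).

Lemma weight_edge w (e : edge G) x y :
  val e = [set x; y]%SET -> weight w x y = w e.
Proof. by move=> exy; rewrite /weight -exy valK. Qed.

Lemma edgeP x y :
  reflect (exists e : edge G, val e = [set x; y]%SET) (adj G x y).
Proof.
apply: (iffP idP) => [xy|[[A /= + Axy]]].
  have xyE : [set x; y]%SET \in edge_set G.
    by rewrite inE; apply/existsP; exists x; apply/existsP; exists y; rewrite xy /=.
  by exists (Sub [set x; y]%SET xyE).
rewrite inE => /existsP[a /existsP[b /andP[ab]]]; rewrite Axy => /eqP /setP eqs.
have ba : a != b by apply: contraTneq ab => ->; rewrite adj_irr.
have := eqs a; have := eqs b; rewrite !inE !eqxx orbT /=.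
case/orP=> /eqP bE; case/orP=> /eqP aE; move: ab ba; rewrite aE bE ?eqxx //.
by rewrite adj_sym.
Qed.

(* The cohesion of an edge does not depend on the order of its endpoints. *)
Lemma cohesionC w x y : cohesion w x y = cohesion w y x.
Proof.
have AC : cohA w x y = cohA w y x by rewrite /cohA addrC.
have BC : cohB w x y = cohB w y x.
  rewrite /cohB; apply: eq_big => [z|z _]; last by rewrite addrC.
  by rewrite !inE andbC.
by rewrite /cohesion /cohC_tilde AC BC.
Qed.

(* Only the restriction of w to [0, +oo[ is constrained. *)
Definition cohesion_flow_solution (w0 : edge G -> R) (w : R -> edge G -> R) :
    Prop :=
  forall e : edge G,
  [/\ {within `[0, +oo[, continuous (fun t => w t e)},
      forall t : R, 0 < t -> forall x y, val e = [set x; y]%SET ->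
        is_derive t 1 (fun s => w s e) (cohesion (w t) x y),
      forall t : R, 0 < t -> 0 < w t e
    & w 0 e = w0 e].

End Cohesion.

(* Main.v *)
Require Import Defs.
From mathcomp Require Import all_boot all_order all_algebra.
From mathcomp Require Import all_classical all_reals all_analysis.
From mathcomp Require Import ring lra.

Set Implicit Arguments.
Unset Strict Implicit.
Unset Printing Implicit Defensive.

Import Order.TTheory GRing.Theory Num.Theory.
Import numFieldNormedType.Exports.

Local Open Scope classical_set_scope.
Local Open Scope ring_scope.

(** Cohesion is bounded, [exp(-1) <= C_e <= exp 1], because [A] and [B] are
nonnegative and so [(A - B) / (A + B)] lies in [[-1, 1]].  The lower bound
makes every solution increase at speed at least [exp(-1)]: this gives strict
monotonicity and divergence ([picard_image_growth]), and it confines solutions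
to the region where all weights are at least [c], the least initial weight.

On that region cohesion is globally Lipschitz, although weights are unbounded:
a perturbation of size [d] of weights at least [c] changes each [1 / w_e] by at
most the fraction [d / c] of itself, hence [A] and [B] too, and a relative
error [k] on [A] and [B] moves their normalized difference by at most [2 k]
([balance_close], [cohesion_lipschitz]).  Replacing each weight by its maximum
with [c] extends this field to a bounded Lipschitz field on the whole space,
and the extended system has the same solutions, as these never leave the
region.

It remains to solve a bounded Lipschitz system on [[0, +oo[]
([picard_fixpoint_exists], [picard_fixpoint_unique]).  Errors are measured
against the weight [expR (2 * L * t)]: if [|u'| <= L * K * expR (2 * L * t)]
and [u 0 = 0] then [|u| <= K / 2 * expR (2 * L * t)], so one Picard step halves
the weighted error on the entire half-line at once
([picard_image_contraction]).  Hence the iterates converge geometrically to a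
fixed point, directly for all times, and the weighted distance between two
fixed points, which is finite because the field is bounded, is halved
indefinitely.  Integration enters only through the
existence of a primitive of a continuous function; all estimates compare
derivatives. *)

(** * Primitives on the half-line *)

(** Differentiability is only required for [t > 0], with continuity at [0]:
the regularity of a solution of an initial value problem at its initial
time. *)
Definition primitive_on_ray (R : realType) (g f : R -> R) : Prop :=
  {within `[0, +oo[, continuous g} /\
  forall t : R, 0 < t -> is_derive t 1 g (f t).

Section Primitive.
Variable R : realType.
Implicit Types (f g h k : R -> R) (t : R).

Lemma primitive_everywhere g f :
  (forall t, 0 <= t -> is_derive t 1 g (f t)) -> primitive_on_ray g f.
Proof.
move=> gf; split=> [|t t0]; last exact/gf/ltW.
apply: derivable_within_continuous => t; rewrite in_itv/= andbT => t0.
by have [] := gf t t0.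
Qed.

(** The primitive integrates from [-1] so that every [t >= 0] is interior to the
range of integration, and no one-sided derivative is needed at [0]. *)
Lemma continuous_has_primitive f :
  continuous f -> exists g, primitive_on_ray g f.
Proof.
move=> cf.
exists (fun t => \int[lebesgue_measure]_(s in `[-1, t]) f s).
apply: primitive_everywhere => t t0.
have t1 : t < t + 1 by lra.
have fint : lebesgue_measure.-integrable `[-1, t + 1] (EFin \o f).
  apply: continuous_compact_integrable; first exact: segment_compact.
  exact: continuous_subspaceT.
have m1t : -1 < t by lra.
have [dF dFE] := continuous_FTC1_closed t1 fint m1t (cf t).
by apply: DeriveDef; [exact: dF|rewrite -derive1E; exact: dFE].
Qed.

Lemma eq_primitive g f h : (forall t, 0 < t -> f t = h t) ->
  primitive_on_ray g f -> primitive_on_ray g h.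
Proof. by move=> fh [cg dg]; split=> // t t0; rewrite -fh//; exact: dg. Qed.

Lemma primitiveB g f k h : primitive_on_ray g f -> primitive_on_ray k h ->
  primitive_on_ray (fun t => g t - k t) (fun t => f t - h t).
Proof.
move=> [cg dg] [ck dk]; split=> [|t t0].
  by move=> x; apply: continuousB; [exact: cg|exact: ck].
by have := dg t t0; have := dk t t0 => ? ?; exact: is_deriveB.
Qed.

Lemma primitive_cst (c : R) : primitive_on_ray (fun=> c) (fun=> 0).
Proof. by apply: primitive_everywhere => t _; exact: is_derive_cst. Qed.

Lemma primitive_id : primitive_on_ray (@id R) (fun=> 1).
Proof. by apply: primitive_everywhere => t _; exact: is_derive_id. Qed.

Lemma primitiveZ (c : R) g f : primitive_on_ray g f ->
  primitive_on_ray (fun t => c * g t) (fun t => c * f t).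
Proof.
move=> [cg dg]; split=> [|t t0].
  by move=> x; apply: continuousM; [exact: cst_continuous|exact: cg].
by have := dg t t0 => ?; exact: is_deriveZ.
Qed.

Lemma primitive_expR (a : R) :
  primitive_on_ray (fun t => expR (a * t)) (fun t => a * expR (a * t)).
Proof.
apply: primitive_everywhere => t _; rewrite mulrC.
have da : is_derive t 1 (fun s : R => a * s) a.
  by rewrite -[X in is_derive _ _ _ X]mulr1; exact: is_deriveZ.
exact: (@is_derive1_comp _ expR).
Qed.

Lemma primitive_ge0_nondecreasing g f : primitive_on_ray g f ->
  (forall t, 0 < t -> 0 <= f t) ->
  forall s t, 0 <= s -> s <= t -> g s <= g t.
Proof.
move=> [cg dg] f0; apply: ger0_derive1_ndecry cg => t;
  rewrite in_itv/= andbT => t0; have dgt := dg t t0.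
- by have [] := dgt.
- by rewrite derive1E derive_val f0.
Qed.

Lemma primitive_le g f k h : primitive_on_ray g f -> primitive_on_ray k h ->
  (forall t, 0 < t -> f t <= h t) ->
  forall s t, 0 <= s -> s <= t -> g t - g s <= k t - k s.
Proof.
move=> gf kh fh s t s0 st.
suff : k s - g s <= k t - g t by lra.
apply: (primitive_ge0_nondecreasing (primitiveB kh gf)) => // r r0.
by rewrite subr_ge0 fh.
Qed.

Lemma primitive_norm_le g f k h :
  primitive_on_ray g f -> primitive_on_ray k h ->
  (forall t, 0 < t -> `|f t| <= h t) ->
  forall s t, 0 <= s -> s <= t -> `|g t - g s| <= k t - k s.
Proof.
move=> gf kh fh s t s0 st; rewrite ler_norml; apply/andP; split.
  rewrite lerNl -mulN1r; have := primitive_le (primitiveZ (-1) gf) kh _ s0 st.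
  rewrite mulrBr; apply => r r0; rewrite mulN1r.
  by apply: le_trans (fh r r0); rewrite -normrN ler_norm.
apply: primitive_le gf kh _ _ _ s0 st => r r0.
by apply: le_trans (fh r r0); exact: ler_norm.
Qed.

Lemma primitive_lipschitz g f (M : R) : primitive_on_ray g f ->
  (forall t, 0 < t -> `|f t| <= M) ->
  forall s t, 0 <= s -> 0 <= t -> `|g t - g s| <= M * `|t - s|.
Proof.
move=> gf fM.
have kM : primitive_on_ray (fun t => M * t) (fun t => M * 1).
  exact: primitiveZ primitive_id.
have H s t : 0 <= s -> s <= t -> `|g t - g s| <= M * `|t - s|.
  move=> s0 st; rewrite [`|t - s|]ger0_norm ?subr_ge0// mulrBr.
  by apply: (primitive_norm_le gf kM) => // r r0; rewrite mulr1 fM.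
move=> s t s0 t0; have [st|/ltW ts] := leP s t; first exact: H.
by rewrite distrC (distrC t); exact: H.
Qed.

(** The gain behind the contraction of Picard's map: integrating against the
exponential weight divides the bound by the rate [a]. *)
Lemma primitive_expR_bound g f (a K : R) : primitive_on_ray g f -> g 0 = 0 ->
  0 <= K -> (forall t, 0 < t -> `|f t| <= a * K * expR (a * t)) ->
  forall t, 0 <= t -> `|g t| <= K * expR (a * t).
Proof.
move=> gf g0 K0 fK t t0.
have := primitive_norm_le gf (primitiveZ K (primitive_expR a)) _ (lexx 0) t0.
rewrite g0 subr0 mulr0 expR0 => H; apply: le_trans (H _) _; last lra.
by move=> r r0; rewrite mulrA (mulrC K); exact: fK.
Qed.

End Primitive.

(** * Global solutions of bounded Lipschitz systems *)

(** The intervals of centre [a n] and radius [2 * C / 2 ^ n] are nested, because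
the radius shrinks by [C / 2 ^ n], the most that the centre can move; the limit
is the supremum of their left ends. *)
Lemma geometric_limit (R : realType) (a : nat -> R) (C : R) :
  (forall n, `|a n.+1 - a n| <= C * 2^-1 ^+ n) ->
  exists l, forall n, `|a n - l| <= 2 * C * 2^-1 ^+ n.
Proof.
move=> aC; set b := fun n => 2 * C * 2^-1 ^+ n.
have bS n : b n.+1 = b n - C * 2^-1 ^+ n by rewrite /b exprS; field.
have C0 : 0 <= C by have := aC 0%N; rewrite expr0 mulr1; apply: le_trans.
have b0 n : 0 <= b n by rewrite /b !mulr_ge0// exprn_ge0.
have low m k : a m - b m <= a (m + k)%N - b (m + k)%N.
  elim: k => [|k]; rewrite ?addn0// addnS bS; have := aC (m + k)%N.
  by rewrite ler_norml => /andP[]; lra.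
have upp m k : a (m + k)%N + b (m + k)%N <= a m + b m.
  elim: k => [|k]; rewrite ?addn0// addnS bS; have := aC (m + k)%N.
  by rewrite ler_norml => /andP[]; lra.
have cross m n : a m - b m <= a n + b n.
  have := low m n; have := upp n m; rewrite addnC.
  by have := b0 (m + n)%N; lra.
set E := range (fun n => a n - b n).
have Eub n : ubound E (a n + b n) by move=> _ [m _ <-].
exists (sup E) => n.
have : a n - b n <= sup E.
  by apply: ub_le_sup; [exists (a 0%N + b 0%N); exact: Eub|exists n].
have : sup E <= a n + b n.
  by apply: ge_sup; [exists (a 0%N - b 0%N), 0%N|exact: Eub].
rewrite -/(b n) ler_norml => *; apply/andP; split; lra.
Qed.

Lemma le_geometric_le0 (R : realType) (x C : R) :
  (forall n, x <= C * 2^-1 ^+ n) -> x <= 0.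
Proof.
move=> xC; have C0 : (fun n => C * 2^-1 ^+ n) @ \oo --> C * 0.
  apply: cvgMr; apply: cvg_expr; rewrite ger0_norm ?invr_ge0//.
  by rewrite invf_lt1 ?ltr1n.
rewrite mulr0 in C0; rewrite -(cvg_lim _ C0)//.
by apply: limr_ge; [apply/cvg_ex; exists 0|apply: nearW].
Qed.

Lemma dist_max_le (R : realDomainType) (a b c : R) :
  `|Num.max a c - Num.max b c| <= `|a - b|.
Proof.
wlog ab : a b / a <= b => [H|].
  have [/H//|/ltW/H] := leP a b; by rewrite distrC (distrC b).
rewrite distrC (distrC a) !ger0_norm ?subr_ge0//.
  by case: (leP a c) => ac; case: (leP b c) => bc; lra.
by rewrite ge_max !le_max ab lexx orbT.
Qed.

Lemma dist_le_continuous (R : realType) (f : R -> R) (k : R) : 0 <= k ->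
  (forall s t : R, `|f t - f s| <= k * `|t - s|) -> continuous f.
Proof.
move=> k0 fk t; apply/(@cvgrPdist_lt _ R) => e e0.
have K0 : 0 < k + 1 by rewrite ltr_pwDr.
have eK : 0 < e / (k + 1) by rewrite divr_gt0.
near=> s.
apply: le_lt_trans (fk s t) _; apply: (@le_lt_trans _ _ ((k + 1) * `|t - s|)).
  by rewrite ler_wpM2r// lerDl.
by rewrite mulrC -ltr_pdivlMr.
Unshelve. all: by end_near. Qed.

(** [F] is Lipschitz for the supremum distance on families indexed by [I]; the
bound [d] on all coordinates stands for that distance. *)
Section Picard.
Variables (R : realType) (I : Type) (F : (I -> R) -> I -> R) (L M : R).
Hypotheses (L_gt0 : 0 < L) (M_ge0 : 0 <= M).
Hypothesis F_bounded : forall x i, `|F x i| <= M.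
Hypothesis F_lipschitz : forall x y (d : R), (forall j, `|x j - y j| <= d) ->
  forall i, `|F x i - F y i| <= L * d.
Implicit Types (u v w : R -> I -> R) (x : I -> R).

(** Picard's map as a relation: [v t = x + int_0^t F (u s) ds].  A solution of
[u' = F u], [u 0 = x] is a [u] with [picard_image u u x]. *)
Definition picard_image u v x : Prop := forall i,
  primitive_on_ray (v ^~ i) (fun t => F (u t) i) /\ v 0 i = x i.

Definition lipschitz_path u := forall s t, 0 <= s -> 0 <= t ->
  forall i, `|u t i - u s i| <= M * `|t - s|.

Lemma picard_image_lipschitz u v x : picard_image u v x -> lipschitz_path v.
Proof.
move=> uv s t s0 t0 i; have [vF _] := uv i.
by apply: (primitive_lipschitz vF).
Qed.

(** The paths on which Picard's map is defined are the [M]-Lipschitz ones: the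
bound on [F] puts all its values among them, and the class is stable under
pointwise limits. *)
Lemma picard_image_exists x u : lipschitz_path u ->
  exists v, picard_image u v x.
Proof.
move=> uM.
suff /choice[v vP] : forall i, exists g : R -> R,
    primitive_on_ray g (fun t => F (u t) i) /\ g 0 = x i.
  by exists (fun t i => v i t).
(* Keeping [u] equal to [u 0] for [t < 0] makes the integrand continuous on the
   whole line. *)
move=> i; pose f (t : R) := F (u (Num.max t 0)) i.
have fL (s t : R) : `|f t - f s| <= L * (M * `|t - s|).
  apply: F_lipschitz => j; apply: le_trans (uM _ _ _ _ j) _.
  - by rewrite le_max lexx orbT.
  - by rewrite le_max lexx orbT.
  by apply: ler_wpM2l => //; exact: dist_max_le.
have cf : continuous f.
  apply: (@dist_le_continuous _ _ (L * M)) => [|s t]; last by rewrite -mulrA.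
  by rewrite mulr_ge0// ltW.
have [g gf] := continuous_has_primitive cf.
exists (fun t => g t - (g 0 - x i)); split; last by rewrite subKr.
apply: eq_primitive (primitiveB gf (primitive_cst (g 0 - x i))) => t t0.
by rewrite subr0 /f max_l// ltW.
Qed.

Lemma picard_image_contraction u v u' v' x (K : R) :
  picard_image u u' x -> picard_image v v' x -> 0 <= K ->
  (forall t, 0 <= t -> forall i, `|u t i - v t i| <= K * expR (2 * L * t)) ->
  forall t, 0 <= t -> forall i,
    `|u' t i - v' t i| <= K * 2^-1 * expR (2 * L * t).
Proof.
move=> uu' vv' K0 uvK t t0 i; have [uF u0] := uu' i; have [vF v0] := vv' i.
apply: (primitive_expR_bound (primitiveB uF vF)) => //.
- by rewrite u0 v0 subrr.
- by rewrite mulr_ge0// invr_ge0.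
move=> r r0; have -> : 2 * L * (K * 2^-1) = L * K by field.
rewrite -mulrA; apply: F_lipschitz => j; apply: uvK; exact: ltW.
Qed.

(** Starts the geometric estimates: two paths of speed at most [M] are at
distance at most [2 * M * t], and [2 * L * t <= expR (2 * L * t)]. *)
Lemma lipschitz_path_dist u v : lipschitz_path u -> lipschitz_path v ->
  u 0 = v 0 ->
  forall t, 0 <= t -> forall i, `|u t i - v t i| <= M / L * expR (2 * L * t).
Proof.
move=> uM vM uv0 t t0 i.
have := uM 0 t (lexx _) t0 i; have := vM 0 t (lexx _) t0 i.
rewrite subr0 uv0 (ger0_norm t0) => vt ut.
have step : `|u t i - v t i| <= M * t + M * t.
  apply: le_trans (ler_distD (v 0 i) _ _) _; rewrite (distrC (v 0 i)).
  exact: lerD.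
apply: le_trans step _; have e1 := expR_ge1Dx (2 * L * t).
have -> : M * t + M * t = M / L * (2 * L * t) by field; rewrite gt_eqF.
by apply: ler_wpM2l; [rewrite divr_ge0// ltW|lra].
Qed.

Lemma picard_fixpoint_unique u v x :
  picard_image u u x -> picard_image v v x ->
  forall t, 0 <= t -> u t = v t.
Proof.
move=> uu vv t t0; apply/funext => i; apply/eqP; rewrite -subr_eq0 -normr_le0.
suff H n : forall s, 0 <= s -> forall j,
    `|u s j - v s j| <= M / L * 2^-1 ^+ n * expR (2 * L * s).
  apply: (@le_geometric_le0 _ _ (M / L * expR (2 * L * t))) => n.
  by rewrite mulrAC; exact: H.
elim: n => [|n IH].
  rewrite expr0 mulr1; apply: lipschitz_path_dist.
  - exact: picard_image_lipschitz uu.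
  - exact: picard_image_lipschitz vv.
  - by apply/funext => j; rewrite (uu j).2 (vv j).2.
rewrite exprSr mulrA; apply: (picard_image_contraction uu vv) IH.
by rewrite mulr_ge0 ?exprn_ge0// divr_ge0// ltW.
Qed.

(** The limit [w] of the iterates satisfies [T w = w] for [t >= 0] only, which
is why the fixed point is taken to be [T w]: it has a derivative by
construction, and the derivative only depends on [w] at positive times. *)
Lemma picard_fixpoint_exists x : exists u, picard_image u u x.
Proof.
have /choice[T TP] : forall u, exists v,
    lipschitz_path u -> picard_image u v x.
  move=> u; have [/(picard_image_exists x)[v]|nu] := pselect (lipschitz_path u).
    by exists v.
  by exists u.
(* [T] is arbitrary on the paths that are not Lipschitz. *)
pose u n := iter n T (fun=> x).
have u_lip n : lipschitz_path (u n).
  elim: n => [|n IH].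
    by move=> s t _ _ i; rewrite subrr normr0 mulr_ge0.
  exact: picard_image_lipschitz (TP _ IH).
have uT n := TP _ (u_lip n).
pose K := M / L; have K0 : 0 <= K by rewrite divr_ge0// ltW.
have Kn0 n : 0 <= K * 2^-1 ^+ n by rewrite mulr_ge0// exprn_ge0.
have u_step n : forall t, 0 <= t -> forall i,
    `|u n.+1 t i - u n t i| <= K * 2^-1 ^+ n * expR (2 * L * t).
  elim: n => [|n IH].
    rewrite expr0 mulr1; apply: lipschitz_path_dist => //.
    by apply/funext => i; exact: (uT 0%N i).2.
  by rewrite exprSr mulrA; exact: picard_image_contraction (uT _) (uT _) _ IH.
have [w wP] : exists w, forall t, 0 <= t -> forall i n,
    `|u n t i - w t i| <= 2 * K * 2^-1 ^+ n * expR (2 * L * t).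
  suff /choice[w wP] : forall ti : R * I, exists l, 0 <= ti.1 -> forall n,
      `|u n ti.1 ti.2 - l| <= 2 * K * 2^-1 ^+ n * expR (2 * L * ti.1).
    by exists (fun t i => w (t, i)) => t t0 i n; exact: (wP (t, i)).
  move=> [t i]/=; case: (leP 0 t) => [t0|_]; last by exists 0.
  have [|l lP] := @geometric_limit _ (fun n => u n t i) (K * expR (2 * L * t)).
    by move=> n; rewrite mulrAC; exact: u_step.
  by exists l => _ n; rewrite mulrAC -[2 * K * _]mulrA; exact: lP.
have w_lip : lipschitz_path w.
  move=> s t s0 t0 i; rewrite -subr_le0.
  apply: (@le_geometric_le0 _ _
    (2 * K * expR (2 * L * t) + 2 * K * expR (2 * L * s))) => n.
  have := wP t t0 i n; have := wP s s0 i n; have := u_lip n s t s0 t0 i.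
  have := ler_distD (u n t i) (w t i) (w s i).
  have := ler_distD (u n s i) (u n t i) (w s i).
  rewrite (distrC (w t i) (u n t i)); lra.
suff Tw t : 0 <= t -> T w t = w t.
  exists (T w) => i; have [_ T0] := TP w w_lip i.
  by split=> //; apply: eq_primitive (TP w w_lip i).1 => t t0; rewrite Tw// ltW.
move=> t0; apply/funext => i; apply/eqP; rewrite -subr_eq0 -normr_le0.
apply: (@le_geometric_le0 _ _ (2 * K * expR (2 * L * t))) => n.
have wu s : 0 <= s -> forall j,
    `|w s j - u n s j| <= 2 * K * 2^-1 ^+ n * expR (2 * L * s).
  by move=> s0 j; rewrite distrC; exact: wP.
have := picard_image_contraction (TP _ w_lip) (uT n) _ wu t0 i.
have := wP t t0 i n.+1; have := ler_distD (u n.+1 t i) (T w t i) (w t i).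
rewrite exprSr mulrAC; have : 0 <= 2 * K * 2^-1 ^+ n by rewrite -mulrA mulr_ge0.
by move=> H1 H2 H3 /(_ H1); rewrite [2 * K * _ * _]mulrAC; lra.
Qed.

End Picard.

(** * Cohesion is a bounded Lipschitz function of the weights *)

Section RelativeError.
Variable R : realFieldType.
Implicit Types (a b k : R).

(** Relative error, measured against the first argument: unlike absolute error
it does not grow with the number of terms of a sum of nonnegative terms. *)
Definition close k a b := `|a - b| <= k * a.

Lemma closeD k a b a' b' : close k a b -> close k a' b' ->
  close k (a + a') (b + b').
Proof.
move=> ab ab'; rewrite /close opprD addrACA mulrDr.
by apply: le_trans (ler_normD _ _) (lerD ab ab').
Qed.

Lemma close_sum k (J : finType) (P : pred J) (f g : J -> R) :
  (forall j, close k (f j) (g j)) ->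
  close k (\sum_(j | P j) f j) (\sum_(j | P j) g j).
Proof.
move=> fg; elim/big_rec2: _ => [|j b a _ ab]; last exact: closeD.
by rewrite /close subrr normr0 mulr0.
Qed.

Lemma close0 k b : close k 0 b -> b = 0.
Proof. by rewrite /close mulr0 normr_le0 sub0r oppr_eq0 => /eqP. Qed.

Definition balance a b := if 0 < a + b then (a - b) / (a + b) else 0.

Lemma balance_norm_le1 a b : 0 <= a -> 0 <= b -> `|balance a b| <= 1.
Proof.
move=> a0 b0; rewrite /balance; case: ifPn => [ab|_]; last by rewrite normr0.
rewrite normrM normfV (gtr0_norm ab) ler_pdivrMr// mul1r.
by rewrite ler_norml; apply/andP; split; lra.
Qed.

(** The numerator of the difference is [2 * (a * b' - a' * b)], that is
[2 * ((a - a') * b' - a' * (b - b'))], at most [2 * k * (a * b' + a' * b)],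
where [a * b' + a' * b] is dominated by the product of the denominators.  The
errors relative to [a'] and [b'] serve the degenerate case: they make both
denominators vanish together. *)
Lemma balance_close k a b a' b' : 0 <= k ->
  0 <= a -> 0 <= b -> 0 <= a' -> 0 <= b' ->
  close k a a' -> close k a' a -> close k b b' -> close k b' b ->
  `|balance a b - balance a' b'| <= 2 * k.
Proof.
move=> k0 a0 b0 a'0 b'0 aa' a'a bb' b'b; rewrite /balance.
have k20 : 0 <= 2 * k by lra.
have [ab|ab] := ltP 0 (a + b); last first.
  have aE : a = 0 by lra.
  have bE : b = 0 by lra.
  rewrite aE in aa'; rewrite bE in bb'.
  by rewrite (close0 aa') (close0 bb') addr0 ltxx subrr normr0.
have [ab'|ab'] := ltP 0 (a' + b'); last first.
  have aE : a' = 0 by lra.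
  have bE : b' = 0 by lra.
  rewrite aE in a'a; rewrite bE in b'b.
  by move: ab; rewrite (close0 a'a) (close0 b'b) addr0 ltxx.
have -> : (a - b) / (a + b) - (a' - b') / (a' + b') =
    2 * ((a - a') * b' - a' * (b - b')) / ((a + b) * (a' + b')).
  by field; rewrite !gt_eqF.
have abab' : 0 < (a + b) * (a' + b') by rewrite mulr_gt0.
rewrite normrM normfV (gtr0_norm abab') ler_pdivrMr//.
rewrite normrM ger0_norm// -mulrA ler_wpM2l//.
apply: le_trans (ler_normB _ _) _.
rewrite !normrM (ger0_norm b'0) (ger0_norm a'0).
have := ler_wpM2r b'0 aa'; have := ler_wpM2l a'0 bb'.
have : 0 <= k * (a * a') by rewrite !mulr_ge0.
have : 0 <= k * (b * b') by rewrite !mulr_ge0.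
rewrite /close; nra.
Qed.

End RelativeError.

(** For [y <= x], [expR y = expR x * expR (y - x) >= expR x * (1 + y - x)]. *)
Lemma expR_lipschitz (R : realType) (x y : R) : x <= 1 -> y <= 1 ->
  `|expR x - expR y| <= expR 1 * `|x - y|.
Proof.
wlog xy : x y / y <= x => [H|x1 _].
  move=> x1 y1; have [/H|/ltW/H] := leP y x; first exact.
  by rewrite distrC (distrC x); exact.
rewrite !ger0_norm ?subr_ge0 ?ler_expR//.
have := expR_ge1Dx (y - x); rewrite -(ler_pM2l (expR_gt0 x)) -expRD subrKC => H.
apply: (@le_trans _ _ (expR x * (x - y))); first by lra.
by rewrite ler_wpM2r ?subr_ge0// ler_expR.
Qed.

Section CohesionLipschitz.
Variables (R : realType) (V : finType) (G : sgraph V).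
Implicit Types (w v : edge G -> R) (x y : V).

Lemma invr_weight_ge0 w x y : (forall e, 0 <= w e) -> 0 <= 1 / weight w x y.
Proof. by move=> w0; rewrite /weight div1r invr_ge0; case: insub => /=. Qed.

Lemma cohA_ge0 w x y : (forall e, 0 <= w e) -> 0 <= cohA w x y.
Proof.
by move=> w0; rewrite addr_ge0// sumr_ge0// => u _; exact: invr_weight_ge0.
Qed.

Lemma cohB_ge0 w x y : (forall e, 0 <= w e) -> 0 <= cohB w x y.
Proof.
move=> w0; rewrite sumr_ge0// => z _.
by rewrite addr_ge0//; exact: invr_weight_ge0.
Qed.

Lemma cohC_tilde_norm_le1 w x y : (forall e, 0 <= w e) ->
  `|cohC_tilde w x y| <= 1.
Proof.
move=> w0; apply: (@balance_norm_le1 _ (cohA w x y) (cohB w x y)).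
- exact: cohA_ge0.
- exact: cohB_ge0.
Qed.

Lemma cohesion_bounds w x y : (forall e, 0 <= w e) ->
  expR (-1) <= cohesion w x y <= expR 1.
Proof.
by move=> w0; rewrite !ler_expR -ler_norml; exact: cohC_tilde_norm_le1.
Qed.

(** [|1/w - 1/v| = |w - v| / (w * v) <= (d / c) * (1/w)].  Pairs that are not
edges have weight [0], whose inverse is [0], for [w] and [v] alike. *)
Lemma invr_weight_close (c d : R) w v x y : 0 < c ->
  (forall e, c <= w e) -> (forall e, c <= v e) ->
  (forall e, `|w e - v e| <= d) ->
  close (d / c) (1 / weight w x y) (1 / weight v x y).
Proof.
move=> c0 cw cv wvd; rewrite /weight /close.
case: insub => [e|]/=; last by rewrite invr0 !mulr0 subr0 normr0.
have we := lt_le_trans c0 (cw e); have ve := lt_le_trans c0 (cv e).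
have -> : 1 / w e - 1 / v e = (v e - w e) / (v e * w e).
  by field; rewrite !gt_eqF.
rewrite normrM normfV (gtr0_norm (mulr_gt0 ve we)) distrC.
rewrite invfM !mulrA mulr1; apply: ler_wpM2r; first by rewrite invr_ge0 ltW.
by apply: ler_pM => //; [rewrite invr_ge0 ltW|rewrite lef_pV2].
Qed.

Lemma cohA_close (c d : R) w v x y : 0 < c ->
  (forall e, c <= w e) -> (forall e, c <= v e) ->
  (forall e, `|w e - v e| <= d) -> close (d / c) (cohA w x y) (cohA v x y).
Proof.
move=> *; apply: closeD; apply: close_sum => u; exact: invr_weight_close.
Qed.

Lemma cohB_close (c d : R) w v x y : 0 < c ->
  (forall e, c <= w e) -> (forall e, c <= v e) ->
  (forall e, `|w e - v e| <= d) -> close (d / c) (cohB w x y) (cohB v x y).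
Proof.
move=> *; apply: close_sum => z; apply: closeD; exact: invr_weight_close.
Qed.

Lemma cohesion_lipschitz (c d : R) w v x y : 0 < c -> 0 <= d ->
  (forall e, c <= w e) -> (forall e, c <= v e) ->
  (forall e, `|w e - v e| <= d) ->
  `|cohesion w x y - cohesion v x y| <= 2 * expR 1 / c * d.
Proof.
move=> c0 d0 cw cv wvd; have vwd e : `|v e - w e| <= d by rewrite distrC.
have w0 e : 0 <= w e by apply: le_trans (cw e); exact: ltW.
have v0 e : 0 <= v e by apply: le_trans (cv e); exact: ltW.
have tilde_le1 (u : edge G -> R) :
    (forall e, 0 <= u e) -> cohC_tilde u x y <= 1.
  by move=> u0; apply: le_trans (ler_norm _) (cohC_tilde_norm_le1 _ _ u0).
apply: le_trans (expR_lipschitz (tilde_le1 _ w0) (tilde_le1 _ v0)) _.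
have -> : 2 * expR 1 / c * d = expR 1 * (2 * (d / c)) by field; rewrite gt_eqF.
rewrite ler_wpM2l ?expR_ge0//.
apply: (@balance_close _ _
  (cohA w x y) (cohB w x y) (cohA v x y) (cohB v x y)).
- by rewrite divr_ge0// ltW.
- exact: cohA_ge0.
- exact: cohB_ge0.
- exact: cohA_ge0.
- exact: cohB_ge0.
- exact: cohA_close.
- exact: cohA_close.
- exact: cohB_close.
- exact: cohB_close.
Qed.

(** Choosing an orientation of every edge turns cohesion into a vector field
indexed by edges; its symmetry makes the choice immaterial. *)
Lemma edge_endpoints : exists p : edge G -> V * V,
  (forall e, val e = [set (p e).1; (p e).2]%SET) /\
  forall w e x y, val e = [set x; y]%SET ->
    cohesion w x y = cohesion w (p e).1 (p e).2.
Proof.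
have /choice[p pP] : forall e : edge G, exists xy : V * V,
    val e = [set xy.1; xy.2]%SET.
  move=> [A /= AE]; have := AE; rewrite inE.
  by move=> /existsP[x /existsP[y /andP[_ /eqP]]]; exists (x, y).
exists p; split=> // w e x y.
move: (pP e); case: (p e) => a b /= -> abxy.
have : x \in [set a; b]%SET by rewrite abxy set21.
have : y \in [set a; b]%SET by rewrite abxy set22.
have : a \in [set x; y]%SET by rewrite -abxy set21.
have : b \in [set x; y]%SET by rewrite -abxy set22.
rewrite !inE => bxy axy /orP[]/eqP yE /orP[]/eqP xE; subst x y.
- by move: bxy; rewrite orbb => /eqP ->.
- exact: cohesionC.
- by [].
- by move: axy; rewrite orbb => /eqP ->.
Qed.

End CohesionLipschitz.

(** * The cohesion flow *)

Section CohesionFlow.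
Variables (R : realType) (V : finType) (G : sgraph V).
Variables (w0 : edge G -> R) (c : R) (p : edge G -> V * V).
Hypotheses (c_gt0 : 0 < c) (w0_ge : forall e, c <= w0 e).
Hypothesis pE : forall e, val e = [set (p e).1; (p e).2]%SET.
Hypothesis cohesion_p : forall (w : edge G -> R) e x y,
  val e = [set x; y]%SET -> cohesion w x y = cohesion w (p e).1 (p e).2.

Definition clamped_cohesion (w : edge G -> R) e : R :=
  cohesion (fun e' => Num.max (w e') c) (p e).1 (p e).2.

Lemma clamped_cohesionE (w : edge G -> R) e : (forall e', c <= w e') ->
  clamped_cohesion w e = cohesion w (p e).1 (p e).2.
Proof.
move=> cw; rewrite /clamped_cohesion.
suff -> : (fun e' => Num.max (w e') c) = w by [].
by apply/funext => e'; rewrite max_l.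
Qed.

Lemma clamped_cohesion_bounds (w : edge G -> R) e :
  expR (-1) <= clamped_cohesion w e <= expR 1.
Proof.
by apply: cohesion_bounds => e'; rewrite le_max (ltW c_gt0) orbT.
Qed.

Lemma clamped_cohesion_norm_le (w : edge G -> R) e :
  `|clamped_cohesion w e| <= expR 1.
Proof.
have /andP[_] := clamped_cohesion_bounds w e.
by rewrite ger0_norm// expR_ge0.
Qed.

Lemma clamped_cohesion_lipschitz (w v : edge G -> R) (d : R) :
  (forall e, `|w e - v e| <= d) -> forall e,
  `|clamped_cohesion w e - clamped_cohesion v e| <= 2 * expR 1 / c * d.
Proof.
move=> wvd e; apply: cohesion_lipschitz => // [|e'|e'|e'].
- exact: le_trans (wvd e).
- by rewrite le_max lexx orbT.
- by rewrite le_max lexx orbT.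
- exact: le_trans (dist_max_le _ _ _) (wvd e').
Qed.

(** The clamped and the original system have the same solutions: in both the
derivatives are positive, so weights stay above their initial values and the
clamp is inactive. *)
Lemma picard_image_solution (w : R -> edge G -> R) :
  picard_image clamped_cohesion w w w0 -> cohesion_flow_solution w0 w.
Proof.
move=> wP.
have cw t : 0 <= t -> forall e, c <= w t e.
  move=> t0 e; apply: le_trans (w0_ge e) _; rewrite -(wP e).2.
  apply: (primitive_ge0_nondecreasing (wP e).1) => // s _.
  exact: expR_ge0.
move=> e; have [[ce de] we0] := wP e; split=> // t t0.
- move=> x y exy; rewrite (cohesion_p _ exy) -clamped_cohesionE.
    exact: de.
  by apply: cw; exact: ltW.
- by apply: lt_le_trans c_gt0 _; apply: cw; exact: ltW.
Qed.

Lemma solution_picard_image (w : R -> edge G -> R) :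
  cohesion_flow_solution w0 w -> picard_image clamped_cohesion w w w0.
Proof.
move=> wP.
have wC e : primitive_on_ray (w ^~ e)
    (fun t => cohesion (w t) (p e).1 (p e).2).
  by have [ce de _ _] := wP e; split=> // t t0; exact: de.
move=> e; have [_ _ _ we0] := wP e; split=> //.
apply: eq_primitive (wC e) => t t0; rewrite clamped_cohesionE// => e'.
have [_ _ _ we'0] := wP e'.
apply: le_trans (w0_ge e') _; rewrite -we'0.
apply: (primitive_ge0_nondecreasing (wC e')) (ltW t0) => // s _.
exact: expR_ge0.
Qed.

Lemma picard_image_growth (w : R -> edge G -> R) x :
  picard_image clamped_cohesion w w x -> forall s t, 0 <= s -> s <= t ->
  forall e, expR (-1) * (t - s) <= w t e - w s e.
Proof.
move=> wP s t s0 st e; rewrite mulrBr.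
apply: (primitive_le (primitiveZ (expR (-1)) (primitive_id R)) (wP e).1) => //.
by move=> r _; rewrite mulr1; have /andP[] := clamped_cohesion_bounds (w r) e.
Qed.

End CohesionFlow.

Theorem theorem2p3 (R : realType) (V : finType) (G : sgraph V)
    (w0 : edge G -> R) :
  connected_graph G -> positive_weights w0 ->
  exists w : R -> edge G -> R,
    [/\ cohesion_flow_solution w0 w,
        forall v : R -> edge G -> R, cohesion_flow_solution w0 v ->
          forall t : R, 0 <= t -> forall e, v t e = w t e,
        forall t : R, 0 <= t -> positive_weights (w t),
        forall (e : edge G) (s t : R), 0 <= s -> s < t -> w s e < w t e
      & forall e : edge G, w t e @[t --> +oo] --> +oo].
Proof.
move=> _ w0_gt0.
pose c := \big[Num.min/1]_(e : edge G) w0 e.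
have c_gt0 : 0 < c by apply: lt_bigmin => // e _; exact: w0_gt0.
have w0_ge e : c <= w0 e by exact: bigmin_le.
have [p [pE cohesion_p]] := edge_endpoints R G.
pose F := clamped_cohesion c p; pose L := 2 * expR 1 / c.
have L_gt0 : 0 < L by rewrite divr_gt0// mulr_gt0// expR_gt0.
have M_ge0 := expR_ge0 (1 : R).
have F_bounded := clamped_cohesion_norm_le p c_gt0.
have F_lipschitz := clamped_cohesion_lipschitz p c_gt0.
have [w wP] := picard_fixpoint_exists L_gt0 M_ge0 F_bounded F_lipschitz w0.
have growth := picard_image_growth c_gt0 wP.
have lt_w e s t : 0 <= s -> s < t -> w s e < w t e.
  move=> s0 st; rewrite -subr_gt0.
  apply: lt_le_trans (growth s t s0 (ltW st) e).
  by rewrite mulr_gt0 ?expR_gt0 ?subr_gt0.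
exists w; split=> //.
- exact: picard_image_solution wP.
- move=> v vsol t t0 e.
  have vP := solution_picard_image w0_ge pE vsol.
  by rewrite (picard_fixpoint_unique L_gt0 M_ge0 F_bounded F_lipschitz vP wP).
- move=> t t0 e; apply: lt_le_trans (w0_gt0 e) _.
  rewrite -(wP e).2 -subr_ge0; apply: le_trans (growth _ _ (lexx 0) t0 e).
  by rewrite subr0 mulr_ge0// expR_ge0.
- move=> e; apply/cvgryPge => A; near=> t.
  have t0 : 0 <= t by near: t; apply: nbhs_pinfty_ge; exact: num_real.
  have tA : A / expR (-1) <= t.
    by near: t; apply: nbhs_pinfty_ge; exact: num_real.
  have := growth 0 t (lexx _) t0 e; rewrite (wP e).2 subr0.
  move: tA; rewrite ler_pdivrMr ?expR_gt0// mulrC => tA.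
  by have := w0_gt0 e; lra.
Unshelve. all: by end_near. Qed.
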